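(* Let $q,a,b$ be nonzero complex numbers with $|q|<1$ and $\max\{|abq|,|aq^2|,|bq^2|\}<1$. Then $$\frac{(q^2,abq;q)_\infty}{(aq^2,bq^2;q)_\infty}\;{}_3\phi_2\left(\begin{matrix}q/a,\,q/b,\,q\\ q^{3/2},\,-q^{3/2}\end{matrix};q,abq\right)=\sum_{n=0}^{\infty}(1-q^{2n+2})\frac{(q/a,q/b;q)_n}{(aq^2,bq^2;q)_n}(-ab)^nq^{n^2+2n}\sum_{j=0}^{n}q^{-j(j+1)/2}.$$
   Context: Notation: $(x;q)_0=1$, $(x;q)_n=\prod_{k=0}^{n-1}(1-xq^k)$, $(x;q)_\infty=\prod_{k=0}^\infty(1-xq^k)$, $(x_1,\dots,x_k;q)_n=(x_1;q)_n\cdots(x_k;q)_n$ (also for $n=\infty$), and $${}_3\phi_2\left(\begin{matrix}A_1,A_2,A_3\\ B_1,B_2\end{matrix};q,z\right)=\sum_{n=0}^\infty\frac{(A_1,A_2,A_3;q)_n}{(q,B_1,B_2;q)_n}z^n .$$ Here $q^{3/2}=(q^{1/2})^3$ for a fixed square root $q^{1/2}$ of $q$ (the series does not depend on the choice). *)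

(* Defs.v *)
From Stdlib Require Import Reals.
From Coquelicot Require Import Coquelicot.

Open Scope C_scope.

(* [iota P] is the unique point satisfying [P] when there is exactly one; hence
   [CSeries] and [qpoch_inf] are the expected limits whenever these exist, and
   carry no information otherwise. *)

Definition CSeries (a : nat -> C) : C :=
  iota (T := C_CompleteNormedModule)
    (fun l : C => is_series (V := C_NormedModule) a l).

Fixpoint qpoch (x q : C) (n : nat) : C :=
  match n with
  | O => 1
  | S k => qpoch x q k * (1 - x * q ^ k)
  end.

Definition qpoch_inf (x q : C) : C :=
  iota (T := C_CompleteNormedModule)
    (fun l : C =>
       filterlim (qpoch x q) eventually (locally (T := C_UniformSpace) l)).

Definition phi32_term (A1 A2 A3 B1 B2 q z : C) (n : nat) : C :=
  (qpoch A1 q n * qpoch A2 q n * qpoch A3 q n)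
  / (qpoch q q n * qpoch B1 q n * qpoch B2 q n) * z ^ n.

Definition phi32 (A1 A2 A3 B1 B2 q z : C) : C :=
  CSeries (phi32_term A1 A2 A3 B1 B2 q z).

(* [sum_n f n] is f 0 + ... + f n, and j (j + 1) / 2 is an exact division of
   naturals. *)
Definition rhs_term (q a b : C) (n : nat) : C :=
  (1 - q ^ (2 * n + 2))
  * ((qpoch (q / a) q n * qpoch (q / b) q n)
     / (qpoch (a * q ^ 2) q n * qpoch (b * q ^ 2) q n))
  * (- (a * b)) ^ n * q ^ (n ^ 2 + 2 * n)
  * sum_n (G := C_AbelianMonoid) (fun j : nat => / q ^ (j * (j + 1) / 2)) n.

(* Main.v *)
(** The right-hand summand is [alpha_n (q/a)_n (q/b)_n z^n / ((aq^2)_n (bq^2)_n)]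
    with [z = abq] and
    [alpha_n = (1-q^(2n+2)) (-1)^n q^(n^2+n) sum_(j<=n) q^(-j(j+1)/2)].
    These [alpha_n] form a Bailey pair relative to [q^2]:
    [sum_(r<=n) alpha_r / ((q)_(n-r) (q)_(n+r+2)) = 1 / (q;q^2)_(n+1)], and the
    left-hand summand is [(1-q) (q/a)_n (q/b)_n z^n / (q;q^2)_(n+1)]. Substituting the
    Bailey pair into the left-hand series and exchanging the two summations leaves,
    for each [r], a series in [n] which the q-Gauss sum evaluates to the [r]-th
    term on the right times a constant quotient of infinite products. *)
Require Import Defs.
From Stdlib Require Import Reals Lra Lia.
From Coquelicot Require Import Coquelicot.
Open Scope C_scope.

(** * Limits and series of complex numbers *)

Local Notation climit u l :=
  (filterlim u eventually (locally (T := C_UniformSpace) (l : C))) (only parsing).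
Local Notation cseries := (is_series (V := C_NormedModule)) (only parsing).
Local Notation csum := (sum_n (G := C_AbelianMonoid)) (only parsing).

Ltac eq_in_C := match goal with |- ?l = ?r => change (@eq C l r) end.

Lemma climit_eps (u : nat -> C) (l : C) :
  climit u l <->
  forall eps : posreal, exists N, forall n, (N <= n)%nat -> (Cmod (u n - l) < eps)%R.
Proof.
  exact (filterlim_locally_ball_norm (K := C_AbsRing) (U := C_NormedModule) (F := eventually) u l).
Qed.

Lemma climit_unique (u : nat -> C) (l m : C) : climit u l -> climit u m -> l = m.
Proof.
  exact (filterlim_locally_unique (V := C_NormedModule) (F := eventually) u l m).
Qed.

Lemma climit_ext (u v : nat -> C) (l : C) :
  (forall n, u n = v n) -> climit u l -> climit v l.
Proof. exact (filterlim_ext u v). Qed.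

Lemma climit_const (c : C) : climit (fun _ => c) c.
Proof. apply filterlim_const. Qed.

Lemma climit_plus (u v : nat -> C) (l m : C) :
  climit u l -> climit v m -> climit (fun n => u n + v n) (l + m).
Proof.
  intros Hu Hv.
  exact (filterlim_comp_2 u v _ Hu Hv (filterlim_plus (V := C_NormedModule) l m)).
Qed.

Lemma climit_mult (u v : nat -> C) (l m : C) :
  climit u l -> climit v m -> climit (fun n => u n * v n) (l * m).
Proof.
  intros Hu Hv P HP.
  (* [filterlim_mult] uses the topology of the absolute ring [C_AbsRing]; [locally_C] carries
     neighbourhoods between it and [C_UniformSpace]. *)
  apply locally_C in HP.
  refine (filterlim_comp_2 u v _ _ _ (filterlim_mult (K := C_AbsRing) l m) P HP).
  - intros Q HQ. apply Hu. now apply locally_C.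
  - intros Q HQ. apply Hv. now apply locally_C.
Qed.

Lemma climit_shift (u : nat -> C) (l : C) (k : nat) :
  climit u l -> climit (fun n => u (k + n)%nat) l.
Proof.
  rewrite !climit_eps. intros H eps. destruct (H eps) as [N HN].
  exists N. intros n Hn. apply HN. lia.
Qed.

Lemma climit_Cmod_le (u : nat -> C) (l : C) (M : R) :
  climit u l -> (forall n, (Cmod (u n) <= M)%R) -> (Cmod l <= M)%R.
Proof.
  rewrite climit_eps. intros H HM. apply Rnot_lt_le. intros Hlt.
  destruct (H (mkposreal (Cmod l - M) ltac:(lra))) as [N HN].
  specialize (HN N (le_n N)). simpl in HN. specialize (HM N).
  pose proof (Cmod_triangle (- (u N - l)) (u N)) as T.
  rewrite Cmod_opp in T.
  replace (- (u N - l) + u N) with l in T by ring. lra.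
Qed.

Lemma climit_Cmod_ge (u : nat -> C) (l : C) (M : R) :
  climit u l -> (forall n, (M <= Cmod (u n))%R) -> (M <= Cmod l)%R.
Proof.
  rewrite climit_eps. intros H HM. apply Rnot_lt_le. intros Hlt.
  destruct (H (mkposreal (M - Cmod l) ltac:(lra))) as [N HN].
  specialize (HN N (le_n N)). simpl in HN. specialize (HM N).
  pose proof (Cmod_triangle (u N - l) l) as T.
  replace (u N - l + l) with (u N) in T by ring. lra.
Qed.

Lemma climit_sum_n (f : nat -> nat -> C) (g : nat -> C) (M : nat) :
  (forall r, climit (fun N => f N r) (g r)) ->
  climit (fun N => csum (f N) M) (csum g M).
Proof.
  intros H. induction M as [|M IH].
  - rewrite sum_O. apply (climit_ext (fun N => f N 0%nat)); [|apply H].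
    intros n. now rewrite sum_O.
  - rewrite sum_Sn. apply (climit_ext (fun N => csum (f N) M + f N (S M))).
    + intros n. now rewrite sum_Sn.
    + now apply climit_plus.
Qed.

Lemma ex_cseries_le (a : nat -> C) (h : nat -> R) :
  (forall n, (Cmod (a n) <= h n)%R) -> ex_series h ->
  exists l : C, cseries a l.
Proof.
  intros H Hh. exact (ex_series_le (V := C_CompleteNormedModule) a h H Hh).
Qed.

Lemma cseries_scal (c : C) (a : nat -> C) (l : C) :
  cseries a l -> cseries (fun n => c * a n) (c * l).
Proof. exact (is_series_scal (V := C_NormedModule) c a l). Qed.

Lemma cseries_unique (a : nat -> C) (l m : C) : cseries a l -> cseries a m -> l = m.
Proof. exact (climit_unique _ l m). Qed.

Lemma CSeries_unique (a : nat -> C) (l : C) : cseries a l -> CSeries a = l.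
Proof.
  intros H. apply (iota_unique (V := C_CompleteNormedModule)); [|exact H].
  intros y Hy. exact (cseries_unique a y l Hy H).
Qed.

Lemma cseries_remainder_le (a : nat -> C) (h : nat -> R) (l : C) (H : R) (M : nat) :
  (forall n, (Cmod (a n) <= h n)%R) -> cseries a l -> is_series h H ->
  (Cmod (l - csum a M) <= H - sum_n h M)%R.
Proof.
  intros Hle Ha Hh.
  apply (climit_Cmod_le (fun n => csum a (S M + n)%nat - csum a M)).
  - apply climit_plus; [|apply climit_const].
    now apply (climit_shift (csum a)).
  - intros n.
    replace (csum a (S M + n)%nat - csum a M)
      with (sum_n_m (G := C_AbelianMonoid) a (S M) (S M + n)).
    2:{ apply (sum_n_m_sum_n (G := C_AbelianGroup) a M (S M + n)). lia. }
    eapply Rle_trans.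
    { apply (norm_sum_n_m (V := C_NormedModule) a (S M) (S M + n)). }
    eapply Rle_trans.
    { apply (sum_n_m_le _ h). exact Hle. }
    eapply Rle_trans.
    { right. apply (sum_n_m_sum_n (G := R_AbelianGroup) h M (S M + n)). lia. }
    unfold minus, plus, opp; cbn -[Nat.add].
    apply Rplus_le_compat_r.
    (* The partial sums of [h] increase, since [h] dominates a modulus, so they stay below [H]. *)
    apply (is_lim_seq_incr_compare (sum_n h) H Hh).
    intros k. rewrite sum_Sn. unfold plus; simpl.
    specialize (Hle (S k)). pose proof (Cmod_ge_0 (a (S k))). lra.
Qed.

(** * Dominated convergence and exchange of summations *)

(** An argument with three thirds of [eps]: from some [M] on, the tail of [h] controls the
    remainders of [f N] and of [g], uniformly in [N], and the sums up to [M] converge as finite sums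
    of limits. *)
Lemma tannery (f : nat -> nat -> C) (g s : nat -> C) (h : nat -> R) (l : C) :
  (forall N r, (Cmod (f N r) <= h r)%R) -> ex_series h ->
  (forall r, climit (fun N => f N r) (g r)) ->
  (forall N, cseries (f N) (s N)) -> cseries g l ->
  climit s l.
Proof.
  intros Hle [H Hh] Hlim Hs Hg.
  assert (Hgle : forall r, (Cmod (g r) <= h r)%R).
  { intros r. apply (climit_Cmod_le (fun N => f N r)); [apply Hlim|]. intros n; apply Hle. }
  apply climit_eps. intros eps.
  assert (e3 : (0 < eps / 3)%R) by (pose proof (cond_pos eps); lra).
  destruct (proj1 (filterlim_locally (F := eventually) (sum_n h) H) Hh (mkposreal _ e3))
    as [M HM].
  specialize (HM M (le_n M)).
  change (Rabs (sum_n h M - H) < eps / 3)%R in HM.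
  apply Rabs_def2 in HM.
  destruct (proj1 (climit_eps _ _) (climit_sum_n f g M Hlim) (mkposreal _ e3)) as [N HN].
  exists N. intros n Hn. specialize (HN n Hn). simpl in HN.
  pose proof (cseries_remainder_le (f n) h (s n) H M (Hle n) (Hs n) Hh) as B1.
  pose proof (cseries_remainder_le g h l H M Hgle Hg Hh) as B2.
  replace (s n - l) with ((s n - csum (f n) M) + ((csum (f n) M - csum g M) + - (l - csum g M)))
    by ring.
  eapply Rle_lt_trans; [apply Cmod_triangle|].
  eapply Rle_lt_trans; [apply Rplus_le_compat_l, Cmod_triangle|].
  rewrite Cmod_opp. lra.
Qed.

Lemma ex_series_geom_scal (K y : R) :
  (0 <= y < 1)%R -> ex_series (fun r => (K * y ^ r)%R).
Proof.
  intros Hy. apply (ex_series_scal_l K (fun r => (y ^ r)%R)).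
  apply ex_series_geom. rewrite Rabs_pos_eq; lra.
Qed.

Lemma sum_geom_le (x : R) (N : nat) :
  (0 <= x < 1)%R -> (sum_n (fun n => (x ^ n)%R) N <= / (1 - x))%R.
Proof.
  intros Hx.
  assert (Hg : is_series (fun n => (x ^ n)%R) (/ (1 - x))%R).
  { apply is_series_geom. rewrite Rabs_pos_eq; lra. }
  apply (is_lim_seq_incr_compare (sum_n (fun n => (x ^ n)%R)) _ Hg).
  intros n. rewrite sum_Sn. unfold plus; simpl.
  pose proof (pow_le x (S n) (proj1 Hx)). simpl in *. lra.
Qed.

Lemma cseries_sum_n (F : nat -> nat -> C) (t : nat -> C) (N : nat) :
  (forall n, cseries (F n) (t n)) ->
  cseries (fun r => csum (fun n => F n r) N) (csum t N).
Proof.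
  intros H. induction N as [|N IH].
  - rewrite sum_O. apply (is_series_ext (V := C_NormedModule) (F 0%nat)); [|apply H].
    intros r. now rewrite sum_O.
  - rewrite sum_Sn.
    apply (is_series_ext (V := C_NormedModule)
      (fun r => plus (csum (fun n => F n r) N) (F (S N) r))).
    + intros r. now rewrite sum_Sn.
    + apply (is_series_plus (V := C_NormedModule)); [exact IH|apply H].
Qed.

(** The partial sum of [t] up to [N] is a series in [r] whose terms are the column sums cut at [N].
    These are dominated by [K / (1 - x) * y ^ r] uniformly in [N] and tend to [s r], so [tannery]
    applies. *)
Lemma cseries_switch (F : nat -> nat -> C) (s t : nat -> C) (l : C) (K x y : R) :
  (0 <= x < 1)%R -> (0 <= y < 1)%R ->
  (forall n r, (Cmod (F n r) <= K * x ^ n * y ^ r)%R) ->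
  (forall r, cseries (fun n => F n r) (s r)) ->
  (forall n, cseries (F n) (t n)) ->
  cseries s l -> cseries t l.
Proof.
  intros Hx Hy HF Hs Ht Hl.
  apply (tannery (fun N r => csum (fun n => F n r) N) s (csum t)
           (fun r => (K / (1 - x) * y ^ r)%R)).
  - intros N r.
    eapply Rle_trans; [apply (norm_sum_n_m (V := C_NormedModule) (fun n => F n r) 0 N)|].
    eapply Rle_trans; [apply (sum_n_m_le _ (fun n => mult (K * y ^ r)%R (x ^ n)%R))|].
    { intros n. eapply Rle_trans; [apply HF|]. unfold mult; simpl. right; ring. }
    eapply Rle_trans.
    { right. exact (sum_n_mult_l (K := R_Ring) (K * y ^ r)%R (fun n => (x ^ n)%R) N). }
    unfold mult; cbn -[pow].
    replace (K / (1 - x) * y ^ r)%R with (K * y ^ r * / (1 - x))%R by (field; lra).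
    apply Rmult_le_compat_l; [|now apply sum_geom_le].
    (* The bound at [n = 0] shows that [K * y ^ r] is nonnegative. *)
    specialize (HF 0%nat r). simpl in HF. pose proof (Cmod_ge_0 (F 0%nat r)). lra.
  - now apply ex_series_geom_scal.
  - exact Hs.
  - intros N. now apply cseries_sum_n.
  - exact Hl.
Qed.

Lemma cseries_finite (a : nat -> C) (n : nat) :
  (forall r, (n < r)%nat -> a r = 0) -> cseries a (csum a n).
Proof.
  intros H. apply climit_eps. intros eps. exists n. intros m Hm.
  enough (E : csum a m = csum a n).
  { change (Cmod (csum a m - csum a n) < eps)%R. rewrite E.
    unfold Cminus. rewrite Cplus_opp_r, Cmod_0. apply cond_pos. }
  induction Hm as [|m Hm IH]; [reflexivity|].
  rewrite sum_Sn, IH, (H (S m)) by lia. apply Cplus_0_r.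
Qed.

Lemma cseries_shift (a : nat -> C) (r : nat) (l : C) :
  (forall n, (n < r)%nat -> a n = 0) ->
  cseries (fun m => a (r + m)%nat) l -> cseries a l.
Proof.
  (* [is_series_decr_n] asks for a positive shift, hence the separate case. *)
  intros H Hl. destruct r as [|r]; [exact Hl|].
  apply (is_series_decr_n (V := C_NormedModule) a (S r)); [lia|].
  replace (plus l _) with l; [exact Hl|].
  simpl.
  assert (E : csum a r = RtoC 0).
  { assert (E : forall m, (m <= r)%nat -> csum a m = RtoC 0); [|now apply E].
    induction m as [|m IH]; intros Hm.
    - rewrite sum_O. apply H; lia.
    - rewrite sum_Sn, IH, H by lia. apply Cplus_0_r. }
  change (l = l + - csum a r). rewrite E. ring.
Qed.

(** * Finite and infinite q-shifted factorials: algebra, uniform bounds, convergence *)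

Lemma qpoch_add (x q : C) (m n : nat) :
  qpoch x q (m + n) = qpoch x q m * qpoch (x * q ^ m) q n.
Proof.
  induction n as [|n IH].
  - rewrite Nat.add_0_r. simpl. ring.
  - rewrite Nat.add_succ_r. simpl. rewrite IH, Cpow_add_r. ring.
Qed.

Lemma qpoch_S_l (x q : C) (n : nat) :
  qpoch x q (S n) = (1 - x) * qpoch (x * q) q n.
Proof.
  change (S n) with (1 + n)%nat. rewrite qpoch_add, Cpow_1_r. simpl. ring.
Qed.

Lemma Cmod_one_minus_le (x : C) : (Cmod (1 - x) <= 1 + Cmod x)%R.
Proof.
  eapply Rle_trans; [apply Cmod_triangle|]. rewrite Cmod_opp, Cmod_1. lra.
Qed.

Lemma Cmod_one_minus_ge (x : C) : (1 - Cmod x <= Cmod (1 - x))%R.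
Proof.
  pose proof (Cmod_triangle (1 - x) x) as T.
  replace (1 - x + x) with (RtoC 1) in T by ring. rewrite Cmod_1 in T. lra.
Qed.

Lemma one_minus_neq0 (x : C) : (Cmod x < 1)%R -> 1 - x <> 0.
Proof.
  intros H E. pose proof (Cmod_one_minus_ge x) as T. rewrite E, Cmod_0 in T. lra.
Qed.

Lemma pow_bounds (t : R) (n : nat) : (0 <= t < 1)%R -> (0 <= t ^ n <= 1)%R.
Proof.
  intros H. split; [apply pow_le; lra|]. rewrite <- (pow1 n). apply pow_incr. lra.
Qed.

Lemma Cmod_mult_pow_le (x q : C) (n : nat) :
  (Cmod q < 1)%R -> (Cmod (x * q ^ n) <= Cmod x)%R.
Proof.
  intros Hq. rewrite Cmod_mult, Cmod_pow.
  pose proof (pow_bounds (Cmod q) n (conj (Cmod_ge_0 q) Hq)).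
  pose proof (Cmod_ge_0 x). nra.
Qed.

Lemma Cmod_pow_lt_1 (q : C) (n : nat) :
  (Cmod q < 1)%R -> (0 < n)%nat -> (Cmod (q ^ n) < 1)%R.
Proof.
  intros Hq Hn. destruct n as [|n]; [lia|].
  rewrite Cpow_S. eapply Rle_lt_trans; [apply Cmod_mult_pow_le|]; assumption.
Qed.

(** Each factor is at most [1 + |x| |q|^k <= exp (|x| |q|^k)], and the exponents form a geometric
    series. The induction keeps its partial sum in closed form. *)
Lemma qpoch_upper (x q : C) (n : nat) :
  (Cmod q < 1)%R -> (Cmod (qpoch x q n) <= exp (Cmod x / (1 - Cmod q)))%R.
Proof.
  intros Hq. pose proof (Cmod_ge_0 q) as Q0. pose proof (Cmod_ge_0 x) as X0.
  apply Rle_trans with (exp (Cmod x * ((1 - Cmod q ^ n) / (1 - Cmod q)))).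
  - induction n as [|n IH]; simpl.
    + rewrite Cmod_1. replace (Cmod x * _)%R with 0%R by (field; lra).
      rewrite exp_0. lra.
    + rewrite Cmod_mult.
      replace (Cmod x * ((1 - Cmod q * Cmod q ^ n) / (1 - Cmod q)))%R
        with (Cmod x * ((1 - Cmod q ^ n) / (1 - Cmod q)) + Cmod x * Cmod q ^ n)%R
        by (field; lra).
      rewrite exp_plus. apply Rmult_le_compat; try apply Cmod_ge_0; [exact IH|].
      eapply Rle_trans; [apply Cmod_one_minus_le|].
      rewrite Cmod_mult, Cmod_pow.
      apply exp_ineq1_le.
  - assert (H : (Cmod x * ((1 - Cmod q ^ n) / (1 - Cmod q)) <= Cmod x / (1 - Cmod q))%R).
    { unfold Rdiv. apply Rmult_le_compat_l; [exact X0|].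
      assert (0 < / (1 - Cmod q))%R by (apply Rinv_0_lt_compat; lra).
      pose proof (pow_bounds (Cmod q) n (conj Q0 Hq)). nra. }
    destruct H as [H|H]; [left; now apply exp_increasing|rewrite H; lra].
Qed.

(** With [p = |q|^k] and [Y = X / (1 - X)], one has [(1 - X p) (1 + Y p) = 1 + X Y p (1 - p) >= 1].
    So each factor has modulus at least [1 - X p >= 1 / (1 + Y p) >= exp (- Y p)], and the exponents
    are again geometric. A bound [X] in place of [|x|] makes the estimate uniform in [x]. *)
Lemma qpoch_lower (x q : C) (X : R) (n : nat) :
  (Cmod q < 1)%R -> (Cmod x <= X)%R -> (X < 1)%R ->
  (exp (- (X / (1 - X) / (1 - Cmod q))) <= Cmod (qpoch x q n))%R.
Proof.
  intros Hq HX HX1. pose proof (Cmod_ge_0 q) as Q0. pose proof (Cmod_ge_0 x) as X0.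
  set (Y := (X / (1 - X))%R).
  assert (Y0 : (0 <= Y)%R).
  { unfold Y, Rdiv. apply Rmult_le_pos; [lra|]. left; apply Rinv_0_lt_compat; lra. }
  apply Rle_trans with (exp (- (Y * ((1 - Cmod q ^ n) / (1 - Cmod q))))).
  - assert (H : (Y * ((1 - Cmod q ^ n) / (1 - Cmod q)) <= Y / (1 - Cmod q))%R).
    { unfold Rdiv. apply Rmult_le_compat_l; [exact Y0|].
      assert (0 < / (1 - Cmod q))%R by (apply Rinv_0_lt_compat; lra).
      pose proof (pow_bounds (Cmod q) n (conj Q0 Hq)). nra. }
    destruct H as [H|H]; [left; apply exp_increasing; lra|rewrite H; lra].
  - induction n as [|n IH]; simpl.
    + rewrite Cmod_1. replace (- (Y * _))%R with 0%R by (field; lra).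
      rewrite exp_0. lra.
    + rewrite Cmod_mult.
      replace (- (Y * ((1 - Cmod q * Cmod q ^ n) / (1 - Cmod q))))%R
        with (- (Y * ((1 - Cmod q ^ n) / (1 - Cmod q))) + - (Y * Cmod q ^ n))%R
        by (field; lra).
      rewrite exp_plus.
      apply Rmult_le_compat; try (left; apply exp_pos); [exact IH|].
      eapply Rle_trans; [|apply Cmod_one_minus_ge].
      rewrite Cmod_mult, Cmod_pow.
      pose proof (pow_bounds (Cmod q) n (conj Q0 Hq)) as Hp.
      set (p := (Cmod q ^ n)%R) in *.
      rewrite exp_Ropp.
      assert (E : (1 + Y * p <= exp (Y * p))%R) by apply exp_ineq1_le.
      assert (HY : (Y * (1 - X) = X)%R) by (unfold Y; field; lra).
      clearbody Y p.
      assert (0 <= Y * p)%R by nra.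
      assert (Hxp : (Cmod x * p <= X * p)%R) by nra.
      assert (X * p <= X)%R by nra.
      apply Rle_trans with (1 - X * p)%R; [|lra].
      apply Rle_trans with (/ (1 + Y * p))%R; [apply Rinv_le_contravar; lra|].
      apply (Rmult_le_reg_r (1 + Y * p)); [lra|].
      rewrite Rinv_l by lra.
      assert (0 <= Y * p * X * (1 - p))%R by (repeat apply Rmult_le_pos; lra).
      nra.
Qed.

Lemma qpoch_neq0 (x q : C) (n : nat) :
  (Cmod q < 1)%R -> (Cmod x < 1)%R -> qpoch x q n <> 0.
Proof.
  intros Hq Hx E.
  pose proof (qpoch_lower x q (Cmod x) n Hq (Rle_refl _) Hx) as H.
  rewrite E, Cmod_0 in H. pose proof (exp_pos (- (Cmod x / (1 - Cmod x) / (1 - Cmod q)))).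
  lra.
Qed.

Lemma qpoch_inv_upper (x q : C) (X : R) (n : nat) :
  (Cmod q < 1)%R -> (Cmod x <= X)%R -> (X < 1)%R ->
  (Cmod (/ qpoch x q n) <= exp (X / (1 - X) / (1 - Cmod q)))%R.
Proof.
  intros Hq HX HX1. pose proof (qpoch_lower x q X n Hq HX HX1) as H.
  rewrite Cmod_inv by (apply qpoch_neq0; lra).
  rewrite exp_Ropp in H.
  rewrite <- (Rinv_inv (exp _)).
  apply Rinv_le_contravar; [|exact H].
  apply Rinv_0_lt_compat, exp_pos.
Qed.

(** The increments [- (x;q)_n x q^n] of the finite products are dominated by a geometric series,
    because the products are bounded. *)
Lemma qpoch_inf_correct (x q : C) :
  (Cmod q < 1)%R -> climit (qpoch x q) (qpoch_inf x q).
Proof.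
  intros Hq.
  assert (H : exists l, climit (qpoch x q) l).
  { destruct (ex_cseries_le (fun n => qpoch x q n * - (x * q ^ n))
      (fun n => (exp (Cmod x / (1 - Cmod q)) * Cmod x * Cmod q ^ n)%R)) as [l Hl].
    - intros n. rewrite Cmod_mult, Cmod_opp, Cmod_mult, Cmod_pow, Rmult_assoc.
      apply Rmult_le_compat_r; [|now apply qpoch_upper].
      apply Rmult_le_pos; [apply Cmod_ge_0|apply pow_le, Cmod_ge_0].
    - apply ex_series_geom_scal. split; [apply Cmod_ge_0|exact Hq].
    (* The increments up to [n] add up to [qpoch x q (S n) - 1], which accounts for both the added 1
       and the shifted index. *)
    - exists (l + 1). apply climit_eps. intros eps.
      destruct (proj1 (climit_eps _ _) Hl eps) as [N HN].
      exists (S N). intros [|n] Hn; [lia|].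
      assert (E : csum (fun n => qpoch x q n * - (x * q ^ n)) n = qpoch x q (S n) - 1).
      { clear. induction n as [|n IH].
        - rewrite sum_O. simpl. ring.
        - rewrite sum_Sn, IH. unfold plus; simpl. ring. }
      specialize (HN n ltac:(lia)).
      replace (qpoch x q (S n) - (l + 1))
        with (csum (fun n => qpoch x q n * - (x * q ^ n)) n - l); [exact HN|].
      rewrite E. ring. }
  destruct H as [l Hl].
  replace (qpoch_inf x q) with l; [exact Hl|]. symmetry.
  exact (iota_filterlim_locally (V := C_CompleteNormedModule) (F := eventually)
    (qpoch x q) l Hl).
Qed.

(** Nonzero factors alone would not suffice: the limit is nonzero because the positive lower bound
    on the finite products is uniform in [n]. *)
Lemma qpoch_inf_neq0 (x q : C) :
  (Cmod q < 1)%R -> (Cmod x < 1)%R -> qpoch_inf x q <> 0.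
Proof.
  intros Hq Hx E.
  pose proof (climit_Cmod_ge _ _ _ (qpoch_inf_correct x q Hq)
    (fun n => qpoch_lower x q (Cmod x) n Hq (Rle_refl _) Hx)) as H.
  rewrite E, Cmod_0 in H. pose proof (exp_pos (- (Cmod x / (1 - Cmod x) / (1 - Cmod q)))).
  lra.
Qed.

Lemma cseries_lim_0 (a : nat -> C) (l : C) : cseries a l -> climit a 0.
Proof.
  intros H. apply climit_eps. intros eps.
  pose proof (climit_plus _ _ _ _ (climit_shift _ _ 1 H)
    (climit_mult _ _ _ _ (climit_const (- (1))) H)) as D.
  replace (l + - (1) * l) with (RtoC 0) in D by ring.
  destruct (proj1 (climit_eps _ _) D eps) as [N HN].
  exists (S N). intros [|n] Hn; [lia|].
  specialize (HN n ltac:(lia)). simpl in HN. rewrite sum_Sn in HN.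
  unfold plus in HN; simpl in HN.
  replace (a (S n) - 0) with (csum a n + a (S n) + - (1) * csum a n - 0) by ring.
  exact HN.
Qed.

Lemma climit_0_geom (u : nat -> C) (K y : R) :
  (0 <= y < 1)%R -> (forall n, (Cmod (u n) <= K * y ^ n)%R) -> climit u 0.
Proof.
  intros Hy Hu.
  destruct (ex_cseries_le u _ Hu (ex_series_geom_scal K y Hy)) as [l Hl].
  exact (cseries_lim_0 u l Hl).
Qed.

Lemma climit_pow (x : C) : (Cmod x < 1)%R -> climit (fun n => x ^ n) 0.
Proof.
  intros Hx. apply (climit_0_geom _ 1 (Cmod x)).
  - split; [apply Cmod_ge_0|exact Hx].
  - intros n. rewrite Cmod_pow. lra.
Qed.

Lemma qpoch_inf_split (x q : C) (n : nat) :
  (Cmod q < 1)%R -> qpoch_inf x q = qpoch x q n * qpoch_inf (x * q ^ n) q.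
Proof.
  intros Hq. apply (climit_unique (fun m => qpoch x q (n + m))).
  - apply (climit_shift (qpoch x q)). now apply qpoch_inf_correct.
  - apply (climit_ext (fun m => qpoch x q n * qpoch (x * q ^ n) q m)).
    + intros m. now rewrite qpoch_add.
    + apply climit_mult; [apply climit_const|now apply qpoch_inf_correct].
Qed.

(** * The q-Gauss sum *)

(** The term of the series 2phi1 with upper parameters [A], [B] and lower parameter [z A B]. Taking
    [z] as the free variable builds in the q-Gauss condition on the argument without dividing by
    [A B]. *)
Definition gauss_term (q A B z : C) (m : nat) : C :=
  qpoch A q m * qpoch B q m / (qpoch q q m * qpoch (z * A * B) q m) * z ^ m.

(** [K] depends on [z] only through the bound [c], so a single [K] serves all the arguments [z q^N]
    in the limit taken in [q_gauss]. *)
Lemma gauss_term_bound (q A B : C) (c : R) :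
  (Cmod q < 1)%R -> (c < 1)%R ->
  exists K, (0 <= K)%R /\
    forall z m, (Cmod (z * A * B) <= c)%R ->
      (Cmod (gauss_term q A B z m) <= K * Cmod z ^ m)%R.
Proof.
  intros Hq Hc.
  exists (exp (Cmod A / (1 - Cmod q)) * exp (Cmod B / (1 - Cmod q)) *
    (exp (Cmod q / (1 - Cmod q) / (1 - Cmod q)) * exp (c / (1 - c) / (1 - Cmod q))))%R.
  split.
  { repeat apply Rmult_le_pos; left; apply exp_pos. }
  intros z m Hz. unfold gauss_term, Cdiv.
  replace (/ (qpoch q q m * qpoch (z * A * B) q m))
    with (/ qpoch q q m * / qpoch (z * A * B) q m)
    by (field; split; apply qpoch_neq0; lra).
  rewrite !Cmod_mult, Cmod_pow.
  apply Rmult_le_compat_r; [apply pow_le, Cmod_ge_0|].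
  apply Rmult_le_compat; try (apply Rmult_le_pos; apply Cmod_ge_0).
  - apply Rmult_le_compat; try apply Cmod_ge_0; now apply qpoch_upper.
  - apply Rmult_le_compat; try apply Cmod_ge_0; apply qpoch_inv_upper; lra.
Qed.

Lemma gauss_ex (q A B z : C) :
  (Cmod q < 1)%R -> (Cmod z < 1)%R -> (Cmod (z * A * B) < 1)%R ->
  exists l : C, cseries (gauss_term q A B z) l.
Proof.
  intros Hq Hz Hc.
  destruct (gauss_term_bound q A B (Cmod (z * A * B)) Hq Hc) as [K [HK H]].
  apply (ex_cseries_le _ (fun m => (K * Cmod z ^ m)%R)).
  - intros m. apply H. lra.
  - apply ex_series_geom_scal. split; [apply Cmod_ge_0|exact Hz].
Qed.

(* The series of differences telescopes: up to the factor [-(1-zAB)] the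
   antidifference is [(1-q^m) t_m], with [t_m] the left-hand term. *)
Lemma gauss_contiguous_sum (q A B z : C) (n : nat) :
  (Cmod q < 1)%R -> (Cmod (z * A * B) < 1)%R ->
  csum (fun m => (1 - z * A * B) * (1 - z) * gauss_term q A B z m
     - (1 - z * A) * (1 - z * B) * gauss_term q A B (z * q) m) n
  = - (1 - z * A * B) * (1 - q ^ S n) * gauss_term q A B z (S n).
Proof.
  intros Hq Hc.
  assert (step : forall m, (1 - z * A * B) * (1 - z) * gauss_term q A B z m
     - (1 - z * A) * (1 - z * B) * gauss_term q A B (z * q) m =
     (1 - z * A * B) * ((1 - q ^ m) * gauss_term q A B z m
        - (1 - q ^ S m) * gauss_term q A B z (S m))).
  { intros m. unfold gauss_term.
    pose proof (qpoch_neq0 q q m Hq Hq) as N1.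
    pose proof (qpoch_neq0 (z * A * B) q m Hq Hc) as N2.
    assert (N3 : 1 - z * A * B <> 0) by now apply one_minus_neq0.
    assert (N4 : 1 - z * A * B * q ^ m <> 0).
    { apply one_minus_neq0. eapply Rle_lt_trans; [now apply Cmod_mult_pow_le|exact Hc]. }
    assert (N5 : 1 - q * q ^ m <> 0).
    { apply one_minus_neq0. eapply Rle_lt_trans; [now apply Cmod_mult_pow_le|exact Hq]. }
    assert (E : qpoch (z * q * A * B) q m
      = qpoch (z * A * B) q m * (1 - z * A * B * q ^ m) / (1 - z * A * B)).
    { pose proof (qpoch_S_l (z * A * B) q m) as E. simpl in E.
      replace (z * A * B * q) with (z * q * A * B) in E by ring.
      rewrite E. field. exact N3. }
    rewrite E. simpl. rewrite Cpow_mult_l.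
    set (x := q ^ m) in *. set (P := qpoch q q m) in *.
    set (Q := qpoch (z * A * B) q m) in *.
    field. auto 10. }
  induction n as [|n IH].
  - rewrite sum_O, step. change (q ^ 0) with (RtoC 1).
    eq_in_C. ring.
  - rewrite sum_Sn, IH, step.
    match goal with |- plus ?l ?k = ?r => change (@eq C (l + k) r) end. ring.
Qed.

(** The telescoped partial sums carry the factor [gauss_term q A B z (S n)], which tends to 0 as the
    term of a convergent series. Hence the difference [d] of the two sides is 0. *)
Lemma gauss_contiguous (q A B z s t : C) :
  (Cmod q < 1)%R -> (Cmod z < 1)%R -> (Cmod (z * A * B) < 1)%R ->
  cseries (gauss_term q A B z) s -> cseries (gauss_term q A B (z * q)) t ->
  (1 - z * A * B) * (1 - z) * s = (1 - z * A) * (1 - z * B) * t.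
Proof.
  intros Hq Hz Hc Hs Ht.
  set (d := (1 - z * A * B) * (1 - z) * s - (1 - z * A) * (1 - z * B) * t).
  enough (E : d = 0).
  { unfold d in E. rewrite <- (Cplus_0_r (_ * t)), <- E. ring. }
  assert (H1 : cseries (fun m => (1 - z * A * B) * (1 - z) * gauss_term q A B z m
     - (1 - z * A) * (1 - z * B) * gauss_term q A B (z * q) m) d).
  { apply (is_series_minus (V := C_NormedModule)); now apply cseries_scal. }
  apply (climit_unique _ _ _ H1).
  apply (climit_ext (fun n => - (1 - z * A * B) * (1 - q * q ^ n)
    * gauss_term q A B z (S n))).
  { intros n. rewrite gauss_contiguous_sum by assumption. reflexivity. }
  replace (RtoC 0) with (- (1 - z * A * B) * (1 + - q * 0) * 0) by ring.
  apply climit_mult; [apply climit_mult; [apply climit_const|]|].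
  - apply (climit_ext (fun n => 1 + - q * q ^ n)); [intros n; ring|].
    apply climit_plus; [apply climit_const|].
    apply climit_mult; [apply climit_const|now apply climit_pow].
  - exact (climit_shift _ _ 1 (cseries_lim_0 _ _ Hs)).
Qed.

Lemma Cmod_shift_lt_1 (x q : C) (n : nat) :
  (Cmod q < 1)%R -> (Cmod x < 1)%R -> (Cmod (x * q ^ n) < 1)%R.
Proof.
  intros Hq Hx. eapply Rle_lt_trans; [now apply Cmod_mult_pow_le|exact Hx].
Qed.

Lemma gauss_iterate (q A B z : C) (s : nat -> C) :
  (Cmod q < 1)%R -> (Cmod z < 1)%R -> (Cmod (z * A * B) < 1)%R ->
  (forall N, cseries (gauss_term q A B (z * q ^ N)) (s N)) ->
  forall N, qpoch (z * A * B) q N * qpoch z q N * s 0%nat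
    = qpoch (z * A) q N * qpoch (z * B) q N * s N.
Proof.
  intros Hq Hz Hc Hs N. induction N as [|N IH]; [reflexivity|].
  assert (E : (1 - z * q ^ N * A * B) * (1 - z * q ^ N) * s N
    = (1 - z * q ^ N * A) * (1 - z * q ^ N * B) * s (S N)).
  { apply (gauss_contiguous q A B (z * q ^ N)); auto.
    - now apply Cmod_shift_lt_1.
    - replace (z * q ^ N * A * B) with (z * A * B * q ^ N) by ring.
      now apply Cmod_shift_lt_1.
    - replace (z * q ^ N * q) with (z * q ^ S N) by (simpl; ring). apply Hs. }
  simpl.
  transitivity (qpoch (z * A * B) q N * qpoch z q N * s 0%nat
    * ((1 - z * q ^ N * A * B) * (1 - z * q ^ N))); [ring|].
  rewrite IH.
  transitivity (qpoch (z * A) q N * qpoch (z * B) q N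
    * ((1 - z * q ^ N * A * B) * (1 - z * q ^ N) * s N)); [ring|].
  rewrite E. ring.
Qed.

(** Iterating the contiguous relation moves the argument from [z] to [z q^N]. As [N] grows, the
    series tends to its zeroth term 1 and the accumulated finite products tend to infinite ones. *)
Theorem q_gauss (q A B z s : C) :
  (Cmod q < 1)%R -> (Cmod z < 1)%R -> (Cmod (z * A * B) < 1)%R ->
  cseries (gauss_term q A B z) s ->
  qpoch_inf (z * A * B) q * qpoch_inf z q * s
    = qpoch_inf (z * A) q * qpoch_inf (z * B) q.
Proof.
  intros Hq Hz Hc Hs.
  assert (HcN : forall N, (Cmod (z * q ^ N * A * B) <= Cmod (z * A * B))%R).
  { intros N. replace (z * q ^ N * A * B) with (z * A * B * q ^ N) by ring.
    now apply Cmod_mult_pow_le. }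
  assert (Hex : forall N, cseries (gauss_term q A B (z * q ^ N))
     (CSeries (gauss_term q A B (z * q ^ N)))).
  { intros N. destruct (gauss_ex q A B (z * q ^ N)) as [l Hl].
    - exact Hq.
    - now apply Cmod_shift_lt_1.
    - eapply Rle_lt_trans; [apply HcN|exact Hc].
    - now rewrite (CSeries_unique _ _ Hl). }
  set (t := fun N => CSeries (gauss_term q A B (z * q ^ N))) in *.
  assert (Ht0 : t 0%nat = s).
  { apply CSeries_unique. now replace (z * q ^ 0) with z by (simpl; ring). }
  assert (Hlim : climit t 1).
  { destruct (gauss_term_bound q A B (Cmod (z * A * B)) Hq Hc) as [K [HK HB]].
    (* The termwise limit [0 ^ m] is 1 at [m = 0] and 0 at every other [m]. *)
    apply (tannery (fun N => gauss_term q A B (z * q ^ N)) (fun m => 0 ^ m) t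
      (fun m => (K * Cmod z ^ m)%R)).
    - intros N m. eapply Rle_trans; [apply HB, HcN|].
      apply Rmult_le_compat_l; [exact HK|]. apply pow_incr.
      split; [apply Cmod_ge_0|now apply Cmod_mult_pow_le].
    - apply ex_series_geom_scal. split; [apply Cmod_ge_0|exact Hz].
    - intros [|m].
      + apply (climit_ext (fun _ => 1)); [|apply climit_const].
        intros N. unfold gauss_term. simpl. field.
      + replace (0 ^ S m) with (RtoC 0) by (simpl; ring).
        (* Since [|z q^N| < 1], its power of exponent [m + 1] is at most [|z| |q|^N]. *)
        apply (climit_0_geom _ (K * Cmod z) (Cmod q)).
        { split; [apply Cmod_ge_0|exact Hq]. }
        intros N. eapply Rle_trans; [apply HB, HcN|].
        rewrite Rmult_assoc. apply Rmult_le_compat_l; [exact HK|].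
        replace (Cmod z * Cmod q ^ N)%R with (Cmod (z * q ^ N))
          by (now rewrite Cmod_mult, Cmod_pow).
        pose proof (Cmod_ge_0 (z * q ^ N)) as T0.
        pose proof (pow_bounds _ m (conj T0 (Cmod_shift_lt_1 z q N Hq Hz))) as T1.
        cbn [pow]. nra.
    - exact Hex.
    - replace (RtoC 1) with (csum (fun m => 0 ^ m) 0) by (rewrite sum_O; reflexivity).
      apply cseries_finite. intros [|r] Hr; [lia|]. simpl. ring. }
  pose proof (gauss_iterate q A B z t Hq Hz Hc Hex) as HI. rewrite Ht0 in HI.
  replace (qpoch_inf (z * A) q * qpoch_inf (z * B) q)
    with (qpoch_inf (z * A) q * qpoch_inf (z * B) q * 1) by ring.
  apply (climit_unique (fun N => qpoch (z * A) q N * qpoch (z * B) q N * t N)).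
  - apply (climit_ext (fun N => qpoch (z * A * B) q N * qpoch z q N * s)); [exact HI|].
    apply climit_mult; [apply climit_mult; now apply qpoch_inf_correct|apply climit_const].
  - apply climit_mult; [apply climit_mult; now apply qpoch_inf_correct|exact Hlim].
Qed.

(** * The Bailey pair relative to [q^2] *)

Definition tri (q : C) (n : nat) : C := q ^ (n * (n + 1) / 2).

Lemma tri_S (q : C) (n : nat) : tri q (S n) = tri q n * (q * q ^ n).
Proof.
  unfold tri. rewrite <- Cpow_S, <- Cpow_add_r. f_equal.
  replace (S n * (S n + 1))%nat with (n * (n + 1) + S n * 2)%nat by ring.
  now rewrite Nat.div_add.
Qed.

Lemma tri_sqr (q : C) (n : nat) : tri q n * tri q n = q ^ (n ^ 2 + n).
Proof.
  induction n as [|n IH]; [unfold tri; simpl; ring|].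
  rewrite tri_S.
  replace (S n ^ 2 + S n)%nat with (n ^ 2 + n + (1 + n + (1 + n)))%nat by (simpl; ring).
  rewrite (Cpow_add_r q (n ^ 2 + n)), <- IH, !Cpow_add_r, Cpow_1_r. ring.
Qed.

Lemma tri_neq0 (q : C) (n : nat) : q <> 0 -> tri q n <> 0.
Proof. apply Cpow_nz. Qed.

(** The power [q^(r^2+r)] is written as the square of [tri q r]: one copy compensates the growth of
    the inner sum, the other supplies decay. *)
Definition bailey_alpha (q : C) (r : nat) : C :=
  (1 - q ^ (2 * r + 2)) * (- (1)) ^ r * (tri q r * tri q r)
  * csum (fun j => / tri q j) r.

(* The summand is [s_r ((1-q^(2n+1)) w(n,r) - w(n-1,r))], where
   [s_r = sum_(j<=r) q^(-j(j+1)/2)] and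
   [w(n,r) = (-1)^r q^(r^2+r) (1-q^(2r+2)) / ((q)_(n-r) (q)_(n+r+2))]. Without [s_r]
   it is the difference [E_r - E_(r+1)] of
   [E_r = (-1)^r q^(r^2+n) (1-q^(2r+1)) / ((q)_(n-r) (q)_(n+r+1))], and
   [q^(-r(r+1)/2) E_r] is again a difference, which is why the sum has a closed form.
   At [m = n] the factor [1 - q^(n-m)] makes it vanish. *)
Lemma bailey_partial (q : C) (n m : nat) :
  q <> 0 -> (Cmod q < 1)%R -> (0 < n)%nat -> (m <= n)%nat ->
  csum (fun r => bailey_alpha q r
      * ((1 - q ^ (2 * n + 1)) - (1 - q ^ (n - r)) * (1 - q ^ (n + r + 2)))
      / (qpoch q q (n - r) * qpoch q q (n + r + 2))) m
  = (- (1)) ^ m * (1 - q ^ (n - m)) * q ^ n * tri q m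
    / (qpoch q q (n - m) * qpoch q q (n + m + 1))
    * (tri q m * (q * q ^ m) * (1 - q ^ (2 * m + 3)) / (1 - q ^ (n + m + 2))
         * csum (fun j => / tri q j) m
       + (1 - q ^ (m + 1)) / (1 - q ^ n)).
Proof.
  intros Hq0 Hq Hn.
  assert (Np : forall k, (0 < k)%nat -> 1 - q ^ k <> 0).
  { intros k Hk. apply one_minus_neq0. now apply Cmod_pow_lt_1. }
  assert (NP : forall k, qpoch q q k <> 0) by (intros k; now apply qpoch_neq0).
  induction m as [|m IH]; intros Hm.
  - rewrite !sum_O. unfold bailey_alpha. rewrite sum_O.
    rewrite Nat.sub_0_r, !Nat.add_0_r.
    replace (n + 2)%nat with (S (S n)) by lia.
    replace (n + 1)%nat with (S n) by lia.
    replace (2 * n + 1)%nat with (n + n + 1)%nat by lia.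
    change (tri q 0) with (RtoC 1). simpl (2 * 0 + 2)%nat. simpl (2 * 0 + 3)%nat.
    cbn [qpoch Nat.add].
    pose proof (Np n Hn) as N1. pose proof (NP n) as N2.
    pose proof (Np (S n) ltac:(lia)) as N3.
    pose proof (Np (S (S n)) ltac:(lia)) as N4.
    rewrite !Cpow_add_r, !Cpow_S in *. change (q ^ 0) with (RtoC 1) in *.
    change ((- (1)) ^ 0) with (RtoC 1).
    set (x := q ^ n) in *. set (Q := qpoch q q n) in *.
    eq_in_C.
    field. repeat split; auto.
  - rewrite sum_Sn, IH by lia. clear IH.
    (* Writing [n = d + S m] removes the truncated subtractions. What remains is a rational identity
       in [q], [q^m], [q^d], [tri q m], the sign, the inner sum and two q-factorials. *)
    destruct (Nat.le_exists_sub (S m) n Hm) as [d [-> _]].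
    unfold bailey_alpha. rewrite (sum_Sn _ m), tri_S.
    replace (d + S m - S m)%nat with d by lia.
    replace (d + S m - m)%nat with (S d) by lia.
    replace (d + S m + S m + 2)%nat with (S (S (d + S m + m + 1)))%nat by lia.
    replace (d + S m + S m + 1)%nat with (S (d + S m + m + 1))%nat by lia.
    cbn [qpoch].
    pose proof (NP d) as N1. pose proof (NP (d + S m + m + 1)%nat) as N2.
    pose proof (Np (S d) ltac:(lia)) as N3.
    pose proof (Np (d + S m)%nat ltac:(lia)) as N4.
    pose proof (Np (S (d + S m + m + 1)) ltac:(lia)) as N5.
    pose proof (Np (S (S (d + S m + m + 1))) ltac:(lia)) as N6.
    pose proof (tri_neq0 q m Hq0) as N7.
    pose proof (Cpow_nz q m Hq0) as N8.
    set (Q := qpoch q q (d + S m + m + 1)) in *.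
    replace (2 * S m + 2)%nat with (S (S m) + S (S m))%nat by lia.
    replace (2 * S m + 3)%nat with (S (S m) + S (S (S m)))%nat by lia.
    replace (2 * m + 3)%nat with (S m + S (S m))%nat by lia.
    replace (2 * (d + S m) + 1)%nat with (d + S m + S (d + S m))%nat by lia.
    rewrite !Cpow_add_r, !Cpow_S in *. rewrite !Cpow_add_r, !Cpow_S in *.
    change (q ^ 0) with (RtoC 1) in *. rewrite !Cmult_1_r in *.
    set (x := q ^ m) in *. set (y := q ^ d) in *. set (P := qpoch q q d) in *.
    set (T := tri q m) in *. set (s := (- (1)) ^ m).
    set (S := sum_n _ m).
    match goal with |- plus (?f) ?g = ?r => change (@eq C (f + g) r) end.
    change (plus S (/ (T * (q * x)))) with (S + / (T * (q * x))).
    clearbody x y P T s S Q.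
    field. repeat split; auto.
Qed.

(** A difference of squares in each factor. It merges the lower parameters [q^(3/2)] and [-q^(3/2)]
    into one symbol in base [q^2]. *)
Lemma qpoch_base_sqr (x q : C) (n : nat) :
  qpoch x q n * qpoch (- x) q n = qpoch (x ^ 2) (q ^ 2) n.
Proof.
  induction n as [|n IH]; cbn [qpoch]; [ring|].
  rewrite <- IH, <- Cpow_mult_r, Nat.mul_comm, Cpow_mult_r. ring.
Qed.

(** Call the left-hand side [beta_n]. At [m = n] the closed form of [bailey_partial] vanishes, which
    says [(1 - q^(2n+1)) beta_n = beta_(n-1)]; the right-hand side satisfies the same recurrence. *)
Theorem bailey_pair (q : C) (n : nat) :
  q <> 0 -> (Cmod q < 1)%R ->
  csum (fun r => bailey_alpha q r / (qpoch q q (n - r) * qpoch q q (n + r + 2))) n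
  = / qpoch q (q ^ 2) (S n).
Proof.
  intros Hq0 Hq.
  assert (Np : forall k, (0 < k)%nat -> 1 - q ^ k <> 0).
  { intros k Hk. apply one_minus_neq0. now apply Cmod_pow_lt_1. }
  assert (NP : forall k, qpoch q q k <> 0) by (intros k; now apply qpoch_neq0).
  induction n as [|n IH].
  - rewrite sum_O. unfold bailey_alpha. rewrite sum_O.
    pose proof (Np 1%nat ltac:(lia)) as N1.
    pose proof (Np 2%nat ltac:(lia)) as N2.
    unfold tri. simpl in *. rewrite !Cmult_1_r in *.
    eq_in_C.
    field. auto.
  - change (csum (fun r => bailey_alpha q r / (qpoch q q (S n - r) * qpoch q q (S n + r + 2)))
      (S n) = / qpoch q (q ^ 2) (S (S n))).
    set (w := fun n r => bailey_alpha q r / (qpoch q q (n - r) * qpoch q q (n + r + 2))).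
    change (csum (w (S n)) (S n) = / qpoch q (q ^ 2) (S (S n))).
    assert (H := bailey_partial q (S n) (S n) Hq0 Hq ltac:(lia) (le_n _)).
    rewrite Nat.sub_diag in H.
    assert (E : (1 - q ^ (2 * S n + 1)) * csum (w (S n)) (S n) - csum (w n) n = 0).
    { etransitivity; [|etransitivity; [exact H|]].
      (* The top index is split off: at [r = S n] the subtraction [n - r] truncates to 0, so [w n r]
         is not the required zero. There the factor [1 - q^0] removes the second part instead. *)
      - rewrite !(sum_Sn _ n).
        assert (P : forall m, (m <= n)%nat -> csum (fun r => bailey_alpha q r
            * ((1 - q ^ (2 * S n + 1)) - (1 - q ^ (S n - r)) * (1 - q ^ (S n + r + 2)))
            / (qpoch q q (S n - r) * qpoch q q (S n + r + 2))) m
          = (1 - q ^ (2 * S n + 1)) * csum (w (S n)) m - csum (w n) m).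
        { assert (P : forall r, (r <= n)%nat -> bailey_alpha q r
            * ((1 - q ^ (2 * S n + 1)) - (1 - q ^ (S n - r)) * (1 - q ^ (S n + r + 2)))
            / (qpoch q q (S n - r) * qpoch q q (S n + r + 2))
            = (1 - q ^ (2 * S n + 1)) * w (S n) r - w n r).
          { intros r Hr. unfold w.
            destruct (Nat.le_exists_sub r n Hr) as [d [-> _]].
            replace (S (d + r) - r)%nat with (S d) by lia.
            replace (d + r - r)%nat with d by lia.
            replace (S (d + r) + r + 2)%nat with (S (d + r + r + 2)) by lia.
            cbn [qpoch].
            pose proof (NP d) as N1. pose proof (NP (d + r + r + 2)%nat) as N2.
            pose proof (Np (S d) ltac:(lia)) as N3.
            pose proof (Np (S (d + r + r + 2)) ltac:(lia)) as N4.
            rewrite !Cpow_S in *.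
            set (x := q ^ (_ + 2)) in *. set (y := q ^ d) in *.
            set (c := q ^ _). clearbody x y c.
            field. auto. }
          induction m as [|m IHm]; intros Hm.
          - rewrite !sum_O. now apply P.
          - rewrite !sum_Sn, IHm, P by lia.
            match goal with |- plus ?f ?g = ?a * plus ?b ?d - plus ?e ?h =>
              change (f + g = a * (b + d) - (e + h)) end. ring. }
        rewrite P by lia.
        change (w (S n) (S n)) with
          (bailey_alpha q (S n) / (qpoch q q (S n - S n) * qpoch q q (S n + S n + 2))).
        rewrite Nat.sub_diag.
        match goal with |- ?a * plus ?b ?d - ?e = plus ?f ?g =>
              change (a * (b + d) - e = f + g) end.
        change (q ^ 0) with (RtoC 1). unfold Cdiv. ring.
      - change (q ^ 0) with (RtoC 1). unfold Cdiv. ring. }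
    change (csum (w n) n = / qpoch q (q ^ 2) (S n)) in IH. rewrite IH in E.
    change (qpoch q (q ^ 2) (S (S n)))
      with (qpoch q (q ^ 2) (S n) * (1 - q * (q ^ 2) ^ S n)).
    rewrite <- Cpow_mult_r, <- Cpow_S.
    replace (S (2 * S n)) with (2 * S n + 1)%nat by lia.
    pose proof (Np (2 * S n + 1)%nat ltac:(lia)) as N1.
    assert (N2 : qpoch q (q ^ 2) (S n) <> 0).
    { apply qpoch_neq0; [apply Cmod_pow_lt_1; [exact Hq|lia]|exact Hq]. }
    set (A := 1 - q ^ (2 * S n + 1)) in *.
    assert (G : forall x y : C, y <> 0 -> A * x - / y = 0 -> x = / (y * A)).
    { intros x y Hy Exy. transitivity (/ A * (A * x - / y) + / (y * A)); [field; auto|].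
      rewrite Exy. ring. }
    now apply G.
Qed.

(** * Geometric bounds, and the two summands rewritten in terms of the Bailey pair *)

(** The product [sigma_r] of [tri q r] with the inner sum satisfies
    [sigma_(r+1) = q^(r+1) sigma_r + 1], so it stays within [1 / (1 - |q|)]. The second copy of
    [tri q r] gives [|q|^r], and [1 - q^(2r+2)] gives the 2. *)
Lemma alpha_bound (q : C) (r : nat) :
  q <> 0 -> (Cmod q < 1)%R ->
  (Cmod (bailey_alpha q r) <= 2 / (1 - Cmod q) * Cmod q ^ r)%R.
Proof.
  intros Hq0 Hq. pose proof (Cmod_ge_0 q) as Q0.
  assert (Ht : (Cmod (tri q r) <= Cmod q ^ r)%R).
  { induction r as [|r IH]; [change (tri q 0) with (RtoC 1); rewrite Cmod_1; simpl; lra|].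
    rewrite tri_S, Cmod_mult, <- Cpow_S, Cmod_pow.
    pose proof (pow_bounds (Cmod q) r (conj Q0 Hq)).
    pose proof (pow_le (Cmod q) (S r) Q0).
    pose proof (Cmod_ge_0 (tri q r)). nra. }
  assert (Hs : (Cmod (tri q r * csum (fun j => / tri q j)%C r) <= / (1 - Cmod q))%R).
  { clear Ht. induction r as [|r IH].
    - rewrite sum_O. change (tri q 0) with (RtoC 1).
      replace (1 * / 1) with (RtoC 1) by field. rewrite Cmod_1.
      rewrite <- Rinv_1 at 1. apply Rinv_le_contravar; lra.
    - rewrite sum_Sn.
      replace (tri q (S r) * _) with
        (q ^ S r * (tri q r * csum (fun j => / tri q j) r) + 1).
      2:{ change (plus ?a ?b) with (a + b).
          rewrite Cpow_S. pose proof (tri_S q r) as E.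
          pose proof (tri_neq0 q (S r) Hq0) as N.
          transitivity (tri q (S r) * csum (fun j => / tri q j) r
            + tri q (S r) * / tri q (S r)); [|ring].
          rewrite Cinv_r by exact N. rewrite E. ring. }
      eapply Rle_trans; [apply Cmod_triangle|].
      rewrite Cmod_1, Cmod_mult, Cmod_pow.
      assert (Hp : (Cmod q ^ S r <= Cmod q)%R).
      { pose proof (pow_bounds (Cmod q) r (conj Q0 Hq)). simpl. nra. }
      pose proof (pow_le (Cmod q) (S r) Q0).
      replace (/ (1 - Cmod q))%R with (Cmod q * / (1 - Cmod q) + 1)%R by (field; lra).
      apply Rplus_le_compat_r. apply Rmult_le_compat; auto using Cmod_ge_0. }
  unfold bailey_alpha.
  replace ((1 - q ^ (2 * r + 2)) * (- (1)) ^ r * (tri q r * tri q r)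
    * csum (fun j => / tri q j) r)
    with ((1 - q ^ (2 * r + 2)) * (- (1)) ^ r
      * (tri q r * csum (fun j => / tri q j) r) * tri q r) by ring.
  rewrite !Cmod_mult, Cmod_pow, Cmod_opp, Cmod_1, pow1, <- Cmod_mult.
  apply Rmult_le_compat; [| |  |exact Ht].
  { repeat apply Rmult_le_pos; try apply Cmod_ge_0; lra. }
  { apply Cmod_ge_0. }
  unfold Rdiv. apply Rmult_le_compat; [|apply Cmod_ge_0| |exact Hs].
  { apply Rmult_le_pos; [apply Cmod_ge_0|lra]. }
  rewrite Rmult_1_r.
  eapply Rle_trans; [apply Cmod_one_minus_le|].
  rewrite Cmod_pow.
  pose proof (pow_bounds (Cmod q) (2 * r + 2) (conj Q0 Hq)). lra.
Qed.

Lemma rhs_term_alpha (q a b : C) (r : nat) :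
  rhs_term q a b r = bailey_alpha q r * (qpoch (q / a) q r * qpoch (q / b) q r * (a * b * q) ^ r)
    / (qpoch (a * q ^ 2) q r * qpoch (b * q ^ 2) q r).
Proof.
  unfold rhs_term, bailey_alpha. rewrite tri_sqr.
  change (fun j => / q ^ (j * (j + 1) / 2)) with (fun j => / tri q j).
  replace (r ^ 2 + 2 * r)%nat with (r ^ 2 + r + r)%nat by lia.
  replace (- (a * b)) with (- (1) * (a * b)) by ring.
  rewrite !(Cpow_add_r q), !Cpow_mult_l. unfold Cdiv. ring.
Qed.

(** The upper parameter [q] cancels the [(q;q)_n] below, the lower parameters merge into
    [(q^3;q^2)_n], and [(1-q) (q^3;q^2)_n = (q;q^2)_(n+1)]. Only [r ^ 2 = q] enters, so either
    square root serves. *)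
Lemma phi32_term_bailey (q r a b : C) (n : nat) :
  r ^ 2 = q -> (Cmod q < 1)%R ->
  phi32_term (q / a) (q / b) q (r ^ 3) (- r ^ 3) q (a * b * q) n
  = (1 - q) * (qpoch (q / a) q n * qpoch (q / b) q n * (a * b * q) ^ n)
    * / qpoch q (q ^ 2) (S n).
Proof.
  intros Hr Hq. unfold phi32_term.
  assert (E : qpoch (r ^ 3) q n * qpoch (- r ^ 3) q n = qpoch (q * q ^ 2) (q ^ 2) n).
  { rewrite qpoch_base_sqr. f_equal. rewrite <- Hr. ring. }
  assert (H2 : (Cmod (q ^ 2) < 1)%R) by (apply Cmod_pow_lt_1; [exact Hq|lia]).
  rewrite qpoch_S_l. rewrite <- (Cmult_assoc (qpoch q q n)), E.
  assert (N1 : qpoch (q * q ^ 2) (q ^ 2) n <> 0).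
  { apply qpoch_neq0; [exact H2|]. now apply Cmod_shift_lt_1. }
  pose proof (qpoch_neq0 q q n Hq Hq) as N2.
  pose proof (one_minus_neq0 q Hq) as N3.
  set (X := qpoch (q * q ^ 2) (q ^ 2) n) in *. set (Y := qpoch q q n) in *.
  unfold Cdiv at 1. field. auto.
Qed.

Lemma Cmod_quot_le (c x y w s t : C) (c' x' y' w' s' t' : R) :
  s <> 0 -> t <> 0 ->
  (Cmod c <= c')%R -> (Cmod x <= x')%R -> (Cmod y <= y')%R -> (Cmod w <= w')%R ->
  (Cmod (/ s) <= s')%R -> (Cmod (/ t) <= t')%R ->
  (Cmod (c * (x * y * w) / (s * t)) <= c' * (x' * y' * w') * (s' * t'))%R.
Proof.
  intros Hs Ht. intros.
  replace (c * (x * y * w) / (s * t)) with (c * (x * y * w) * (/ s * / t)) by (field; auto).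
  rewrite !Cmod_mult.
  repeat (apply Rmult_le_compat;
    [repeat apply Rmult_le_pos; apply Cmod_ge_0|repeat apply Rmult_le_pos; apply Cmod_ge_0
    | |]); assumption.
Qed.

Lemma rhs_term_bound (q a b : C) :
  q <> 0 -> (Cmod q < 1)%R -> (Cmod (a * q ^ 2) < 1)%R -> (Cmod (b * q ^ 2) < 1)%R ->
  (Cmod (a * b * q) <= 1)%R ->
  exists K, forall r, (Cmod (rhs_term q a b r) <= K * Cmod q ^ r)%R.
Proof.
  intros Hq0 Hq Ha Hb Hz.
  set (U := exp (Cmod (q / a) / (1 - Cmod q))).
  set (V := exp (Cmod (q / b) / (1 - Cmod q))).
  set (A := exp (Cmod (a * q ^ 2) / (1 - Cmod (a * q ^ 2)) / (1 - Cmod q))).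
  set (B := exp (Cmod (b * q ^ 2) / (1 - Cmod (b * q ^ 2)) / (1 - Cmod q))).
  exists (2 / (1 - Cmod q) * (U * V * 1) * (A * B))%R. intros r.
  rewrite rhs_term_alpha.
  replace (2 / (1 - Cmod q) * (U * V * 1) * (A * B) * Cmod q ^ r)%R with
    (2 / (1 - Cmod q) * Cmod q ^ r * (U * V * 1) * (A * B))%R by ring.
  apply Cmod_quot_le; try (now apply qpoch_neq0); try (now apply qpoch_upper);
    try (apply qpoch_inv_upper; lra).
  - now apply alpha_bound.
  - rewrite Cmod_pow, <- (pow1 r). apply pow_incr. split; [apply Cmod_ge_0|exact Hz].
Qed.

(** * The double series and its row and column sums *)

(** The test [r <= n] encodes the convention that [1 / (q;q)_(n-r)] is 0 at negative index, which
    truncated subtraction would violate. *)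
Definition pair_term (q u v z : C) (n r : nat) : C :=
  if Nat.leb r n then
    bailey_alpha q r * (qpoch u q n * qpoch v q n * z ^ n)
      / (qpoch q q (n - r) * qpoch q q (n + r + 2))
  else 0.

Lemma pair_term_row (q u v z : C) (n : nat) :
  q <> 0 -> (Cmod q < 1)%R ->
  cseries (pair_term q u v z n)
    (qpoch u q n * qpoch v q n * z ^ n * / qpoch q (q ^ 2) (S n)).
Proof.
  intros Hq0 Hq. rewrite <- (bailey_pair q n Hq0 Hq).
  set (c := qpoch u q n * qpoch v q n * z ^ n).
  replace (c * _) with (csum (pair_term q u v z n) n).
  - apply cseries_finite. intros r Hr. unfold pair_term.
    destruct (Nat.leb_spec r n); [lia|reflexivity].
  - rewrite <- (sum_n_mult_l (K := C_Ring)).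
    apply sum_n_ext_loc. intros r Hr. unfold pair_term.
    destruct (Nat.leb_spec r n); [|lia].
    change (bailey_alpha q r * c / (qpoch q q (n - r) * qpoch q q (n + r + 2)) =
      c * (bailey_alpha q r / (qpoch q q (n - r) * qpoch q q (n + r + 2)))).
    unfold Cdiv. ring.
Qed.

(** With [n = r + m], the denominator [(q)_(n+r+2)] splits as [(q)_(2r+2) (q^(2r+3))_m]. Since
    [z u v = q^3], the base [q^(2r+3)] equals [z (u q^r) (v q^r)], exactly the lower parameter that
    q-Gauss requires. *)
Lemma pair_term_col (q u v z : C) (r : nat) :
  q <> 0 -> (Cmod q < 1)%R -> (Cmod z < 1)%R -> z * u * v = q ^ 3 ->
  (Cmod (z * u) < 1)%R -> (Cmod (z * v) < 1)%R ->
  cseries (fun n => pair_term q u v z n r)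
    (bailey_alpha q r * (qpoch u q r * qpoch v q r * z ^ r)
      / (qpoch (z * u) q r * qpoch (z * v) q r)
     * (qpoch_inf (z * u) q * qpoch_inf (z * v) q / (qpoch_inf q q * qpoch_inf z q))).
Proof.
  intros Hq0 Hq Hz E Hu Hv.
  set (c := z * (u * q ^ r) * (v * q ^ r)).
  assert (Ec : c = q * q ^ (r + r + 2)).
  { unfold c. transitivity (z * u * v * (q ^ r * q ^ r)); [ring|].
    rewrite E, !Cpow_add_r. ring. }
  assert (Hc : (Cmod c < 1)%R) by (rewrite Ec; now apply Cmod_shift_lt_1).
  destruct (gauss_ex q (u * q ^ r) (v * q ^ r) z Hq Hz Hc) as [s Hs].
  pose proof (q_gauss q _ _ z s Hq Hz Hc Hs) as G. fold c in G.
  apply (cseries_shift _ r).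
  { intros n Hn. unfold pair_term. destruct (Nat.leb_spec r n); [lia|reflexivity]. }
  pose proof (qpoch_neq0 q q (r + r + 2) Hq Hq) as N0.
  replace (bailey_alpha q r * _ / _ * _) with
    (bailey_alpha q r * (qpoch u q r * qpoch v q r * z ^ r) / qpoch q q (r + r + 2) * s).
  - apply (is_series_ext (V := C_NormedModule) (fun m =>
      bailey_alpha q r * (qpoch u q r * qpoch v q r * z ^ r) / qpoch q q (r + r + 2)
      * gauss_term q (u * q ^ r) (v * q ^ r) z m)); [|now apply cseries_scal].
    intros m. unfold pair_term.
    destruct (Nat.leb_spec r (r + m)); [|lia].
    replace (r + m - r)%nat with m by lia.
    replace (r + m + r + 2)%nat with (r + r + 2 + m)%nat by lia.
    rewrite !(qpoch_add _ _ _ m), Cpow_add_r, <- Ec.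
    unfold gauss_term. fold c.
    pose proof (qpoch_neq0 q q m Hq Hq) as N1.
    pose proof (qpoch_neq0 c q m Hq Hc) as N2.
    eq_in_C.
    field. auto.
  (* Splitting each infinite product at its shift confines the dependence on [r] to finite symbols
     and leaves a quotient independent of [r]. *)
  - pose proof (qpoch_inf_split q q (r + r + 2) Hq) as S1. rewrite <- Ec in S1.
    pose proof (qpoch_inf_split (z * u) q r Hq) as S2.
    pose proof (qpoch_inf_split (z * v) q r Hq) as S3.
    replace (z * u * q ^ r) with (z * (u * q ^ r)) in S2 by ring.
    replace (z * v * q ^ r) with (z * (v * q ^ r)) in S3 by ring.
    pose proof (qpoch_inf_neq0 c q Hq Hc) as N1.
    pose proof (qpoch_inf_neq0 z q Hq Hz) as N2.
    pose proof (qpoch_neq0 (z * u) q r Hq Hu) as N3.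
    pose proof (qpoch_neq0 (z * v) q r Hq Hv) as N4.
    assert (Es : s = qpoch_inf (z * (u * q ^ r)) q * qpoch_inf (z * (v * q ^ r)) q
      / (qpoch_inf c q * qpoch_inf z q)).
    { rewrite <- G. field. auto. }
    rewrite Es, S1, S2, S3. field. auto 10.
Qed.

(** The decay in [n] comes from [z^n] and the decay in [r] from [bailey_alpha]; together they give
    the product bound required by [cseries_switch]. *)
Lemma pair_term_bound (q u v z : C) :
  q <> 0 -> (Cmod q < 1)%R ->
  exists K, forall n r, (Cmod (pair_term q u v z n r) <= K * Cmod z ^ n * Cmod q ^ r)%R.
Proof.
  intros Hq0 Hq.
  set (M := exp (Cmod q / (1 - Cmod q) / (1 - Cmod q))).
  set (U := exp (Cmod u / (1 - Cmod q))). set (V := exp (Cmod v / (1 - Cmod q))).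
  assert (M0 : (0 < M)%R) by apply exp_pos.
  assert (U0 : (0 < U)%R) by apply exp_pos.
  assert (V0 : (0 < V)%R) by apply exp_pos.
  assert (D0 : (0 < 2 / (1 - Cmod q))%R) by (apply Rdiv_lt_0_compat; lra).
  exists (2 / (1 - Cmod q) * (U * V) * (M * M))%R. intros n r.
  pose proof (pow_le (Cmod z) n (Cmod_ge_0 z)) as Z0.
  pose proof (pow_le (Cmod q) r (Cmod_ge_0 q)) as Q0.
  unfold pair_term. destruct (Nat.leb_spec r n).
  - replace (_ * Cmod z ^ n * Cmod q ^ r)%R with
      (2 / (1 - Cmod q) * Cmod q ^ r * (U * V * Cmod z ^ n) * (M * M))%R by ring.
    apply Cmod_quot_le; try (now apply qpoch_neq0); try (now apply qpoch_upper);
      try (apply qpoch_inv_upper; lra).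
    + now apply alpha_bound.
    + rewrite Cmod_pow. lra.
  - rewrite Cmod_0. repeat apply Rmult_le_pos; lra.
Qed.

(** * Convergence of both sides and the identity itself *)

Theorem theorem4p4 (q r a b : C)
  (hr : r ^ 2 = q)
  (hq0 : q <> 0) (ha0 : a <> 0) (hb0 : b <> 0)
  (hq1 : (Cmod q < 1)%R)
  (hmax : (Rmax (Rmax (Cmod (a * b * q)) (Cmod (a * q ^ 2)))
                (Cmod (b * q ^ 2)) < 1)%R) :
  ex_series (V := C_NormedModule)
    (phi32_term (q / a) (q / b) q (r ^ 3) (- r ^ 3) q (a * b * q)) /\
  ex_series (V := C_NormedModule) (rhs_term q a b) /\
  (qpoch_inf (q ^ 2) q * qpoch_inf (a * b * q) q)
  / (qpoch_inf (a * q ^ 2) q * qpoch_inf (b * q ^ 2) q)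
  * phi32 (q / a) (q / b) q (r ^ 3) (- r ^ 3) q (a * b * q)
  = CSeries (rhs_term q a b).
Proof.
  apply Rmax_Rlt in hmax as [hmax Hb]. apply Rmax_Rlt in hmax as [Hz Ha].
  set (u := q / a). set (v := q / b). set (z := a * b * q) in *.
  (* The pairing is crossed: [z v] cancels [b] and [z u] cancels [a]. *)
  assert (Eu : z * v = a * q ^ 2) by (unfold z, v; field; exact hb0).
  assert (Ev : z * u = b * q ^ 2) by (unfold z, u; field; exact ha0).
  assert (Euv : z * u * v = q ^ 3) by (rewrite Ev; unfold v; field; exact hb0).
  assert (Hrhs : exists l : C, cseries (rhs_term q a b) l).
  { destruct (rhs_term_bound q a b hq0 hq1 Ha Hb) as [K HK]; [exact (Rlt_le _ _ Hz)|].
    apply (ex_cseries_le _ _ HK), ex_series_geom_scal.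
    split; [apply Cmod_ge_0|exact hq1]. }
  destruct Hrhs as [l Hl].
  (* The constant quotient that q-Gauss produces in every column. *)
  set (c := qpoch_inf (b * q ^ 2) q * qpoch_inf (a * q ^ 2) q
    / (qpoch_inf q q * qpoch_inf z q)).
  assert (Hs : forall r, cseries (fun n => pair_term q u v z n r) (c * rhs_term q a b r)).
  { intros k. pose proof (pair_term_col q u v z k) as H.
    rewrite Ev, Eu in H. specialize (H hq0 hq1 Hz).
    replace (c * rhs_term q a b k) with
     (bailey_alpha q k * (qpoch u q k * qpoch v q k * z ^ k) /
       (qpoch (b * q ^ 2) q k * qpoch (a * q ^ 2) q k) * c).
    - apply H; auto. now rewrite <- Ev.
    - rewrite rhs_term_alpha. fold u v z. rewrite (Cmult_comm (qpoch (a * q ^ 2) q k)).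
      ring. }
  destruct (pair_term_bound q u v z hq0 hq1) as [K HK].
  assert (HL : cseries (fun n => qpoch u q n * qpoch v q n * z ^ n
      * / qpoch q (q ^ 2) (S n)) (c * l)).
  { apply (cseries_switch (pair_term q u v z) (fun k => c * rhs_term q a b k) _ _
      K (Cmod z) (Cmod q)).
    - split; [apply Cmod_ge_0|exact Hz].
    - split; [apply Cmod_ge_0|exact hq1].
    - exact HK.
    - exact Hs.
    - intros n. now apply pair_term_row.
    - now apply cseries_scal. }
  assert (HP : cseries (phi32_term u v q (r ^ 3) (- r ^ 3) q z) ((1 - q) * (c * l))).
  { apply (is_series_ext (V := C_NormedModule) (fun n => (1 - q)
      * (qpoch u q n * qpoch v q n * z ^ n * / qpoch q (q ^ 2) (S n)))).
    - intros n. unfold u, v, z. rewrite phi32_term_bailey by assumption.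
      apply Cmult_assoc.
    - now apply cseries_scal. }
  split; [now exists ((1 - q) * (c * l))|]. split; [now exists l|].
  unfold phi32. rewrite (CSeries_unique _ _ HP), (CSeries_unique _ _ Hl).
  (* As [(q;q)_inf = (1-q) (q^2;q)_inf], the prefactor of the theorem is the inverse of
     [(1 - q) * c]. *)
  pose proof (qpoch_inf_split q q 1 hq1) as Eq.
  replace (q * q ^ 1) with (q ^ 2) in Eq by ring.
  replace (qpoch q q 1) with (1 - q) in Eq by (simpl; ring).
  unfold c. rewrite Eq.
  assert (H2 : (Cmod (q ^ 2) < 1)%R) by (apply Cmod_pow_lt_1; [exact hq1|lia]).
  field. repeat split; try (now apply qpoch_inf_neq0). now apply one_minus_neq0.
Qed.
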